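(* Let $U$ be a unitary complex $n\times n$ matrix with $\operatorname{tr}U=0$. Then the unit circle $\{z\in\mathbb{C}:|z|=1\}$ is the smallest circle enclosing the eigenvalues of $U$. Moreover, the greatest lower bound on $\operatorname{Spd}(U)$ is $\sqrt3$: one has $\operatorname{Spd}(U)\ge\sqrt3$ for every $n$ and every unitary $n\times n$ matrix $U$ of trace zero, and $\sqrt3$ is the largest constant for which this holds.
   Context: The spread of a complex $n\times n$ matrix $A$ with eigenvalues $\lambda_1,\dots,\lambda_n$ is $\operatorname{Spd}(A)=\max_{i,j}|\lambda_i-\lambda_j|$. A circle encloses a set of points if all of them lie in the closed disk it bounds; the smallest such circle is the one of minimal radius. *)

(* Defs.v *)
From HB Require Import structures.
From mathcomp Require Import all_boot all_order all_algebra.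
From mathcomp Require Import boolp classical_sets reals.
From mathcomp Require Import complex.

Set Implicit Arguments.
Unset Strict Implicit.
Unset Printing Implicit Defensive.

Import Order.TTheory GRing.Theory Num.Theory.
Import ComplexField.Normc.

Local Open Scope ring_scope.
Local Open Scope complex_scope.
Local Open Scope classical_set_scope.

(* The eigenvalues of A listed with algebraic multiplicity, in an unspecified
   order: char_poly A is monic and R[i] is algebraically closed. *)
Definition eigenvalues (R : realType) (n : nat) (A : 'M[R[i]]_n) : seq R[i] :=
  sval (closed_field_poly_normal (char_poly A)).

Lemma char_poly_eigenvalues (R : realType) (n : nat) (A : 'M[R[i]]_n) :
  char_poly A = \prod_(z <- eigenvalues A) ('X - z%:P).
Proof.
rewrite /eigenvalues; case: closed_field_poly_normal => r /= {1}->.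
by rewrite (monicP (char_poly_monic A)) scale1r.
Qed.

Lemma size_eigenvalues (R : realType) (n : nat) (A : 'M[R[i]]_n) :
  size (eigenvalues A) = n.
Proof.
by have := size_char_poly A; rewrite char_poly_eigenvalues size_prod_XsubC => -[].
Qed.

Lemma mem_eigenvalues (R : realType) (n : nat) (A : 'M[R[i]]_n) (z : R[i]) :
  (z \in eigenvalues A) = eigenvalue A z.
Proof.
by rewrite eigenvalue_root_char char_poly_eigenvalues root_prod_XsubC.
Qed.

(* The default value 0 of the maximum is harmless: for n > 0 it is the
   diagonal term |x - x|. *)
Definition spread (R : realType) (n : nat) (A : 'M[R[i]]_n) : R :=
  \big[Num.max/0]_(x <- eigenvalues A)
    \big[Num.max/0]_(y <- eigenvalues A) normc (x - y).

Definition circle (R : realType) (c : R[i]) (r : R) : set R[i] :=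
  [set z | normc (z - c) = r].

Definition closed_disk (R : realType) (c : R[i]) (r : R) : set R[i] :=
  [set z | normc (z - c) <= r].

(* Circles of radius 0 are admitted, so that a one-point set has a smallest
   enclosing circle. "The" smallest circle: minimal radius, and no other
   enclosing circle has the same radius. *)
Definition smallest_enclosing_circle (R : realType) (K S : set R[i]) : Prop :=
  exists (c : R[i]) (r : R),
    [/\ 0 <= r, K = circle c r, S `<=` closed_disk c r
      & forall (c' : R[i]) (r' : R), 0 <= r' -> S `<=` closed_disk c' r' ->
          r <= r' /\ (r' = r -> c' = c)].

(* Main.v *)
Require Import Defs.
From mathcomp Require Import all_boot all_order all_algebra.
From mathcomp Require Import spectral.
From mathcomp Require Import boolp classical_sets reals.
From mathcomp Require Import complex.
From mathcomp Require Import ring lra.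
Set Implicit Arguments.
Unset Strict Implicit.
Unset Printing Implicit Defensive.

Import Order.TTheory GRing.Theory Num.Theory.
Import ComplexField.Normc.
Local Open Scope ring_scope.
Local Open Scope complex_scope.
Local Open Scope classical_set_scope.

(** Everything reduces to plane geometry: the eigenvalues [z_1, ..., z_n] of a
    unitary matrix lie on the unit circle
    ([normc_unitary_eigenvalue]) and their sum is the trace
    ([sum_eigenvalues]), hence zero.

    If a disk of centre [c] and radius [r] contains all the [z_k], the average
    of [|z_k - c|^2 = 1 - 2 <c, z_k> + |c|^2] is at most [r^2]; the cross terms
    cancel because the [z_k] sum to zero, and [1 + |c|^2 <= r^2] remains
    ([unit_sum0_radius]).  So [r >= 1], with equality only for [c = 0].

    For the spread, let [a], [b] be eigenvalues whose scalar product
    [t = <a, b>] is minimal, that is, a farthest pair.  If [t > -1/2], then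
    every unit vector [z] with [<a, z>, <b, z> >= t] has [<a + b, z> > 0]
    ([cdot_gram] and [gram_sum_gt0]): geometrically, all the eigenvalues lie in
    one open half-plane.  Then they cannot sum to zero.  So [t <= -1/2] and
    [|a - b|^2 = 2 - 2 t >= 3] ([unit_sum0_far_pair]).  The diagonal matrix of
    the three cube roots of unity attains the bound ([spread_cube_roots]). *)

(** * The Euclidean plane underlying the complex numbers *)

Definition cdot (R : rcfType) (x y : R[i]) : R :=
  complex.Re x * complex.Re y + complex.Im x * complex.Im y.

Lemma cdotC (R : rcfType) (x y : R[i]) : cdot x y = cdot y x.
Proof. by rewrite /cdot; ring. Qed.

Lemma cdotDr (R : rcfType) (c : R[i]) : {morph cdot c : x y / x + y}.
Proof. by case=> [a b] [a' b']; rewrite /cdot /=; ring. Qed.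

Lemma cdot0r (R : rcfType) (c : R[i]) : cdot c 0 = 0.
Proof. by rewrite /cdot /=; ring. Qed.

Lemma cdot_sumr (R : rcfType) (c : R[i]) (s : seq R[i]) :
  \sum_(z <- s) cdot c z = cdot c (\sum_(z <- s) z).
Proof. by rewrite (big_morph _ (cdotDr c) (cdot0r c)). Qed.

Lemma normc_ge0 (R : rcfType) (x : R[i]) : 0 <= normc x.
Proof. by case: x => a b; apply: sqrtr_ge0. Qed.

Lemma sqr_normcE (R : rcfType) (x : R[i]) : normc x ^+ 2 = cdot x x.
Proof.
case: x => a b; rewrite /cdot /= sqr_sqrtr ?addr_ge0 ?sqr_ge0 //.
Qed.

Lemma sqr_normcB (R : rcfType) (x y : R[i]) :
  normc (x - y) ^+ 2 = normc x ^+ 2 + normc y ^+ 2 - 2 * cdot x y.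
Proof.
by rewrite !sqr_normcE /cdot; case: x => a b; case: y => a' b' /=; ring.
Qed.

(** Three vectors of the plane are linearly dependent, so their Gram
    determinant vanishes. *)
Lemma cdot_gram (R : rcfType) (a b c : R[i]) :
  normc a = 1 -> normc b = 1 -> normc c = 1 ->
  cdot a c ^+ 2 + cdot b c ^+ 2 + cdot a b ^+ 2
  = 1 + 2 * cdot a b * cdot a c * cdot b c.
Proof.
move=> ha hb hc.
have [a1 b1 c1] : [/\ cdot a a = 1, cdot b b = 1 & cdot c c = 1].
  by rewrite -!sqr_normcE ha hb hc expr1n.
suff gram : cdot a a * cdot b b * cdot c c
    + 2 * cdot a b * cdot a c * cdot b c
    = cdot a a * cdot b c ^+ 2 + cdot b b * cdot a c ^+ 2
      + cdot c c * cdot a b ^+ 2.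
  by move: gram; rewrite a1 b1 c1 !mul1r => ->; ring.
by rewrite /cdot; ring.
Qed.

(** Here [t], [x], [y] are the scalar products [<a, b>], [<a, z>], [<b, z>] of
    three unit vectors of the plane, and the equation is their Gram relation
    [Q = 1 - t^2], where [Q = x^2 + y^2 - 2 t x y].  If [x + y <= 0], then
    [(x, y)] is in the triangle with vertices [(t, t)], [(t, -t)], [(-t, t)],
    on which [Q] is at most [2 t^2 (1 - t)].  For [-1/2 < t <= 0] this is less
    than [1 - t^2], the difference being [(1 - t)^2 (1 + 2 t)].  At the
    threshold [t = -1/2] there is equality at the vertex [(t, t)]: three
    vectors at mutual angles of 120 degrees. *)
Lemma gram_sum_gt0 (R : realFieldType) (t x y : R) :
  - (1 / 2) < t -> t <= x -> t <= y ->
  x ^+ 2 + y ^+ 2 + t ^+ 2 = 1 + 2 * t * x * y -> 0 < x + y.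
Proof.
move=> t_gt tx ty gram.
case: (ltP 0 (x + y)) => // xy_le0; exfalso.
have t_le0 : t <= 0 by lra.
(* With [w = x + y - 2 t], the bound on [Q] comes from
   [Q = 2 t^2 (1 - t) + 2 t (1 - t) w + w^2 - 2 (1 + t) (x - t) (y - t)] and
   [w^2 <= - 2 t w]: what is left over is [- 2 t^2 w]. *)
have vertex : 0 < (1 - t) * (1 + 2 * t) by apply: mulr_gt0; lra.
have corner : 0 <= (1 + t) * (x - t) * (y - t).
  by apply: mulr_ge0; [apply: mulr_ge0|]; lra.
have strip : 0 <= (x + y - 2 * t) * - (x + y) by apply: mulr_ge0; lra.
have leftover : 0 <= t ^+ 2 * (x + y - 2 * t) by rewrite mulr_ge0 ?sqr_ge0 //; lra.
nra.
Qed.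

(** * Unit vectors whose sum is zero *)

(** Since the barycentre of the points is 0, the mean of the squared distances to [c] is exactly
    [1 + |c|^2].  The extra term [|c|^2] also gives the uniqueness of the
    centre of a smallest disk. *)
Lemma unit_sum0_radius (R : rcfType) (s : seq R[i]) (c : R[i]) (r : R) :
  s != [::] -> (forall z, z \in s -> normc z = 1) -> \sum_(z <- s) z = 0 ->
  (forall z, z \in s -> normc (z - c) <= r) -> 1 + normc c ^+ 2 <= r ^+ 2.
Proof.
move=> s_neq0 s_unit s_sum0 s_disk.
have le_sum : \sum_(z <- s) normc (z - c) ^+ 2 <= \sum_(z <- s) r ^+ 2.
  rewrite big_seq [leRHS]big_seq; apply: ler_sum => z zs.
  by apply: lerXn2r; rewrite ?nnegrE ?normc_ge0 ?s_disk //;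
    apply: le_trans (normc_ge0 (z - c)) (s_disk _ zs).
have sumE : \sum_(z <- s) normc (z - c) ^+ 2
    = \sum_(z <- s) (1 + normc c ^+ 2).
  transitivity (\sum_(z <- s) (1 + normc c ^+ 2 - 2 * cdot c z)).
    rewrite big_seq [RHS]big_seq; apply: eq_bigr => z zs.
    by rewrite sqr_normcB s_unit // expr1n cdotC.
  by rewrite sumrB -mulr_sumr cdot_sumr s_sum0 cdot0r mulr0 subr0.
move: le_sum; rewrite sumE !big_const_seq !iter_addr_0 count_predT.
by rewrite lerMn2r size_eq0 (negPf s_neq0).
Qed.

Lemma exists_min_pair (R : realDomainType) (T : choiceType) (s : seq T)
    (f : T -> T -> R) :
  s != [::] ->
  exists a b, [/\ a \in s, b \in s &
    forall x y, x \in s -> y \in s -> f a b <= f x y].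
Proof.
case: s => // z s _; set zs := z :: s.
pose z0 : seq_sub zs := SeqSub (mem_head z s).
case: (@arg_minP _ _ _ (z0, z0) xpredT
  (fun p : seq_sub zs * seq_sub zs => f (val p.1) (val p.2)) isT) => p _ p_min.
exists (val p.1), (val p.2); split; try exact: ssvalP.
by move=> x y xs ys; apply: (p_min (SeqSub xs, SeqSub ys) isT).
Qed.

(** On the unit circle, [3 <= |a - b|^2] means [<a, b> <= -1/2].  For a pair
    with minimal scalar product the contrary would put every point strictly
    on the positive side of the line orthogonal to [a + b], which a family
    with sum zero excludes. *)
Lemma unit_sum0_far_pair (R : rcfType) (s : seq R[i]) :
  s != [::] -> (forall z, z \in s -> normc z = 1) -> \sum_(z <- s) z = 0 ->
  exists a b, [/\ a \in s, b \in s & Num.sqrt 3 <= normc (a - b)].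
Proof.
move=> s_neq0 s_unit s_sum0.
have [a [b [sa sb ab_min]]] := exists_min_pair (@cdot R) s_neq0.
exists a, b; split=> //.
suff ab_le : cdot a b <= - (1 / 2).
  have far : 3 <= normc (a - b) ^+ 2.
    by rewrite sqr_normcB !s_unit // expr1n; lra.
  by rewrite -(ger0_norm (normc_ge0 (a - b))) -sqrtr_sqr ler_wsqrtr.
rewrite leNgt; apply/negP => ab_gt.
have pos z : z \in s -> 0 < cdot a z + cdot b z.
  move=> zs; apply: (@gram_sum_gt0 _ (cdot a b)); rewrite ?ab_min //.
  by apply: cdot_gram; apply: s_unit.
have sum0 : \sum_(z <- s) (cdot a z + cdot b z) = 0.
  by rewrite big_split /= !cdot_sumr s_sum0 !cdot0r addr0.
have : 0 < \sum_(z <- s) (cdot a z + cdot b z).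
  case: s s_neq0 pos {s_unit s_sum0 sa sb ab_min sum0} => // z s _ pos.
  rewrite big_cons ltr_wpDr ?pos ?mem_head // big_seq sumr_ge0 // => w ws.
  by rewrite ltW // pos // inE ws orbT.
by rewrite sum0 ltxx.
Qed.

(** * Spectrum of a unitary matrix *)

Lemma sum_eigenvalues (R : realType) (n : nat) (A : 'M[R[i]]_n) :
  (0 < n)%N -> \sum_(z <- eigenvalues A) z = \tr A.
Proof.
move=> n_gt0; apply: oppr_inj; rewrite -(char_poly_trace A) //.
rewrite char_poly_eigenvalues -[in n.-1](size_eigenvalues A).
by rewrite coefPn_prod_XsubC // size_eigenvalues -lt0n.
Qed.

(** A unitary matrix preserves the Hermitian norm of an eigenvector [v],
    so [|z|^2 <v, v> = <z v, z v> = <v U, v U> = <v, v>]. *)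
Lemma normc_unitary_eigenvalue (R : rcfType) (n : nat) (U : 'M[R[i]]_n)
    (z : R[i]) :
  U \is unitarymx -> eigenvalue U z -> normc z = 1.
Proof.
move=> U_unitary /eigenvalueP[v vU v_neq0].
have dot_gt0 : 0 < dotmx v v by apply: dotmx_is_dotmx.
have dotU : `|z| ^+ 2 * dotmx v v = dotmx v v.
  rewrite normCK !dotmxE.
  transitivity ((z *: v *m map_mx Num.conj (z *: v)^T) 0 0).
    by rewrite linearZ /= map_mxZ -scalemxAl -scalemxAr !mxE mulrA.
  rewrite -vU trmx_mul map_mxM mulmxA -[v *m U *m _]mulmxA.
  by rewrite (unitarymxP U_unitary) mulmx1.
have /eqP : `|z| ^+ 2 = 1.
  by apply: (mulIf (lt0r_neq0 dot_gt0)); rewrite mul1r.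
rewrite sqrp_eq1 ?normr_ge0 // => /eqP /(congr1 (@complex.Re R)) /= <-.
by case: z {vU dotU}.
Qed.

Lemma diag_mx_unitary (R : rcfType) (n : nat) (d : 'rV[R[i]]_n) :
  (forall i, normc (d 0 i) = 1) -> diag_mx d \is unitarymx.
Proof.
move=> d_unit; apply/unitarymxP.
rewrite tr_diag_mx map_diag_mx mulmx_diag -diag_const_mx; congr diag_mx.
apply/rowP => i; rewrite !mxE -normCK.
have -> : `|d 0 i| = 1.
  by rewrite -[RHS]/((1 : R)%:C) -(d_unit i); case: (d 0 i).
by rewrite expr1n.
Qed.

Lemma eigenvalue_diag_mx (F : fieldType) (n : nat) (d : 'rV[F]_n) (z : F) :
  eigenvalue (diag_mx d) z -> exists i, z = d 0 i.
Proof.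
rewrite eigenvalue_root_char char_poly_trig ?diag_mx_is_trig //.
rewrite rootE horner_prod => /prodf_eq0[i _].
by rewrite !hornerE !mxE eqxx mulr1n subr_eq0 => /eqP ->; exists i.
Qed.

Lemma le_spread (R : realType) (n : nat) (A : 'M[R[i]]_n) (x y : R[i]) :
  eigenvalue A x -> eigenvalue A y -> normc (x - y) <= spread A.
Proof.
rewrite -!mem_eigenvalues => xA yA; rewrite /spread.
apply: le_trans (le_bigmax_seq _ x _ _ xA isT).
exact: (le_bigmax_seq _ y _ _ yA isT).
Qed.

Lemma spread_le (R : realType) (n : nat) (A : 'M[R[i]]_n) (r : R) :
  0 <= r ->
  (forall x y, eigenvalue A x -> eigenvalue A y -> normc (x - y) <= r) ->
  spread A <= r.
Proof.
move=> r_ge0 Ar; rewrite /spread big_seq; apply: bigmax_le => // x xA.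
rewrite big_seq; apply: bigmax_le => // y yA.
by apply: Ar; rewrite -mem_eigenvalues.
Qed.

Lemma smallest_enclosing_circle_unitary (R : realType) (n : nat)
    (U : 'M[R[i]]_n) :
  (0 < n)%N -> U \is unitarymx -> \tr U = 0 ->
  smallest_enclosing_circle [set z : R[i] | normc z = 1]
    [set z : R[i] | eigenvalue U z].
Proof.
move=> n_gt0 U_unitary trU.
exists 0, 1; split=> //.
- by apply/seteqP; split=> z; rewrite /circle /= subr0.
- move=> z zU; rewrite /closed_disk /= subr0.
  by rewrite (normc_unitary_eigenvalue U_unitary zU).
move=> c r r_ge0 Ucr.
have radius : 1 + normc c ^+ 2 <= r ^+ 2.
  apply: (@unit_sum0_radius _ (eigenvalues U)).
  - by rewrite -size_eq0 size_eigenvalues -lt0n.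
  - by move=> z; rewrite mem_eigenvalues; apply: normc_unitary_eigenvalue.
  - by rewrite sum_eigenvalues.
  - by move=> z; rewrite mem_eigenvalues => /Ucr.
have nc_ge0 := sqr_ge0 (normc c); split=> [|r1]; first by nra.
apply: eq0_normc; apply/eqP; rewrite -sqrf_eq0 eq_le nc_ge0 andbT.
by move: radius; rewrite r1 expr1n; lra.
Qed.

Lemma spread_unitary_ge (R : realType) (n : nat) (U : 'M[R[i]]_n) :
  (0 < n)%N -> U \is unitarymx -> \tr U = 0 -> Num.sqrt 3 <= spread U.
Proof.
move=> n_gt0 U_unitary trU.
have [||| a [b [aU bU far]]] := @unit_sum0_far_pair _ (eigenvalues U).
- by rewrite -size_eq0 size_eigenvalues -lt0n.
- by move=> z; rewrite mem_eigenvalues; apply: normc_unitary_eigenvalue.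
- by rewrite sum_eigenvalues.
by apply: le_trans far _; apply: le_spread; rewrite -mem_eigenvalues.
Qed.

(** * The cube roots of unity *)

Definition cube_roots (R : rcfType) : 'rV[R[i]]_3 :=
  \row_i [:: 1; - (1 / 2) +i* (Num.sqrt 3 / 2);
             - (1 / 2) -i* (Num.sqrt 3 / 2)]`_i.

Lemma cdot_cube_roots (R : rcfType) (i j : 'I_3) :
  cdot (cube_roots R 0 i) (cube_roots R 0 j) = if i == j then 1 else - (1 / 2).
Proof.
have s3 : Num.sqrt 3 ^+ 2 = 3 :> R by rewrite sqr_sqrtr ?ler0n.
rewrite /cdot !mxE; case: i => [[|[|[|//]]] ?]; case: j => [[|[|[|//]]] ?];
  rewrite -val_eqE /=; try lra; nra.
Qed.

Lemma normc_cube_roots (R : rcfType) (i : 'I_3) : normc (cube_roots R 0 i) = 1.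
Proof.
apply/eqP; rewrite -sqrp_eq1 ?normc_ge0 // sqr_normcE cdot_cube_roots.
by rewrite eqxx.
Qed.

Lemma spread_cube_roots (R : realType) :
  spread (diag_mx (cube_roots R)) <= Num.sqrt 3.
Proof.
apply: spread_le; first exact: sqrtr_ge0.
move=> x y /eigenvalue_diag_mx[i ->] /eigenvalue_diag_mx[j ->].
rewrite -[leLHS](ger0_norm (normc_ge0 _)) -sqrtr_sqr ler_wsqrtr //.
rewrite sqr_normcB !normc_cube_roots expr1n cdot_cube_roots.
by case: ifP => _; lra.
Qed.

Lemma trace_cube_roots (R : rcfType) : \tr (diag_mx (cube_roots R)) = 0.
Proof.
rewrite mxtrace_diag !big_ord_recl big_ord0 !mxE /=.
by apply/eqP; rewrite eq_complex /=; apply/andP; split; apply/eqP; field.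
Qed.

Theorem theorem3p1 (R : realType) :
  [/\ forall (n : nat) (U : 'M[R[i]]_n), (0 < n)%N ->
        U \is unitarymx -> \tr U = 0 ->
        smallest_enclosing_circle [set z : R[i] | normc z = 1]
          [set z : R[i] | eigenvalue U z],
      forall (n : nat) (U : 'M[R[i]]_n), (0 < n)%N ->
        U \is unitarymx -> \tr U = 0 -> Num.sqrt 3 <= spread U
    & forall c : R,
        (forall (n : nat) (U : 'M[R[i]]_n), (0 < n)%N ->
           U \is unitarymx -> \tr U = 0 -> c <= spread U) ->
        c <= Num.sqrt 3].
Proof.
split.
- exact: smallest_enclosing_circle_unitary.
- exact: spread_unitary_ge.
move=> c c_le; apply: le_trans (spread_cube_roots R); apply: c_le => //.
- by apply: diag_mx_unitary => i; apply: normc_cube_roots.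
- exact: trace_cube_roots.
Qed.
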